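(* Let $\mathcal{X}\subset\mathbb{Z}$ be a finite alphabet, let $\bm{X}=(X_1,\dots,X_N)^T$ be a random vector with joint probability mass function $f:\mathcal{X}^N\to[0,1]$, let $\mathbb{F}_q$ be a finite field with $|\mathcal{X}|\le q$, and let $\mathcal{F}:\mathcal{X}\to\hat{\mathcal{X}}\subseteq\mathbb{F}_q$ be a bijection onto its image $\hat{\mathcal{X}}$. Let $\bm{A}$ be an $L\times N$ coding matrix with i.i.d. entries uniformly distributed over $\mathbb{F}_q$ and statistically independent of $\bm{X}$. Let $P_e$ be the probability of error of the maximum a posteriori (MAP) decoder that recovers $\hat{\bm{x}}=\mathcal{F}[\bm{x}]$ from $\bm{A}$ and the $L$ network coded symbols $\hat{\bm{y}}=\bm{A}\hat{\bm{x}}$. Then $$P_e \le \min_{0\le\rho\le 1} 2^{-\rho L\log_2 q+\rho H_\rho(\bm{X})-D_{KL}(f_\rho(\bm{x})\,\|\,f(\bm{x}))},$$ where $f_\rho$ is the tilted distribution $$f_\rho(\bm{x})=\frac{f(\bm{x})^{\frac{1}{1+\rho}}}{\sum_{\bm{x}'\in\mathcal{X}^N}f(\bm{x}')^{\frac{1}{1+\rho}}},\qquad \bm{x}\in\mathcal{X}^N,$$ $H_\rho(\bm{X})=-\sum_{\bm{x}\in\mathcal{X}^N}f_\rho(\bm{x})\log_2 f_\rho(\bm{x})$ is its entropy, and $D_{KL}(f_\rho\|f)$ is the Kullback-Leibler divergence of $f$ from $f_\rho$.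
   Context: Source vector: a realization $\bm{x}\in\mathcal{X}^N$ of $\bm{X}$ is mapped componentwise to $\hat{\bm{x}}=\mathcal{F}[\bm{x}]\in\hat{\mathcal{X}}^N\subseteq\mathbb{F}_q^N$. The joint pmf of the mapped vector is $\hat f(\hat{\bm{x}})=f(\mathcal{F}^{-1}[\hat{\bm{x}}])$ for $\hat{\bm{x}}\in\hat{\mathcal{X}}^N$ and $\hat f(\hat{\bm{x}})=0$ for $\hat{\bm{x}}\in\mathbb{F}_q^N\setminus\hat{\mathcal{X}}^N$. Observation: the decoder knows $\bm{A}\in\mathbb{F}_q^{L\times N}$ and $\hat{\bm{y}}=\bm{A}\hat{\bm{x}}\in\mathbb{F}_q^L$ (arithmetic in $\mathbb{F}_q$). MAP decoding rule: the decoder outputs $$\hat{\bm{x}}^*=\arg\max_{\hat{\bm{x}}\in\hat{\mathcal{X}}^N}\mathbb{1}_{\{\bm{A},\hat{\bm{y}}\}}(\hat{\bm{x}})\,\hat f(\hat{\bm{x}}),$$ where $\mathbb{1}_{\{\bm{A},\hat{\bm{y}}\}}(\hat{\bm{x}})=1$ if $\bm{A}\hat{\bm{x}}=\hat{\bm{y}}$ and $0$ otherwise. The error event is that the output $\hat{\bm{x}}^*$ differs from the transmitted $\hat{\bm{x}}$ (when there are several maximizers, i.e. another $\hat{\bm{w}}\neq\hat{\bm{x}}$ with $\bm{A}\hat{\bm{w}}=\hat{\bm{y}}$ and $\hat f(\hat{\bm{w}})\ge\hat f(\hat{\bm{x}})$, this is counted as an error). $P_e$ is the probability of the error event over the joint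 randomness of $\bm{X}$ and $\bm{A}$. Conventions: $0\log_2 0=0$, and $D_{KL}(g\|f)=\sum_{\bm{x}\in\mathcal{X}^N}g(\bm{x})\log_2\frac{g(\bm{x})}{f(\bm{x})}$ with terms where $g(\bm{x})=0$ equal to $0$. *)

(* Defs.v *)
From HB Require Import structures.
From mathcomp Require Import all_boot all_order all_algebra finmap.
From mathcomp Require Import all_classical all_reals all_analysis.

Set Implicit Arguments.
Unset Strict Implicit.
Unset Printing Implicit Defensive.

Import Order.TTheory GRing.Theory Num.Theory.

Local Open Scope classical_set_scope.
Local Open Scope ring_scope.

Section finite_valued_random_variables.
Context (R : realType) (d : measure_display) (T : measurableType d)
  (P : probability T R).

(* Measurability with respect to the discrete sigma-algebra on [S]. *)
Definition finite_RV (S : finType) (Y : T -> S) : Prop :=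
  forall s : S, measurable (Y @^-1` [set s]).

Definition has_pmf (S : finType) (Y : T -> S) (f : S -> R) : Prop :=
  forall s : S, P (Y @^-1` [set s]) = (f s)%:E.

Definition independent_RV (S1 S2 : finType) (Y1 : T -> S1) (Y2 : T -> S2) :
    Prop :=
  forall (B1 : set S1) (B2 : set S2),
    P ((Y1 @^-1` B1) `&` (Y2 @^-1` B2)) =
    (P (Y1 @^-1` B1) * P (Y2 @^-1` B2))%E.

Definition mutually_independent_RV (I S : finType) (Y : I -> T -> S) : Prop :=
  forall (J : {set I}) (B : I -> set S),
    P (\bigcap_(i in [set` J]) (Y i @^-1` B i)) =
    (\prod_(i in J) P (Y i @^-1` B i))%E.

Definition iid_uniform_entries (F : finFieldType) (L N : nat)
    (A : T -> 'M[F]_(L, N)) : Prop :=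
  (forall (i : 'I_L) (j : 'I_N),
     has_pmf (fun t => A t i j) (fun=> #|F|%:R^-1)) /\
  mutually_independent_RV (fun (ij : 'I_L * 'I_N) t => A t ij.1 ij.2).

End finite_valued_random_variables.

Section map_decoding.
Context (R : realType) (F : finFieldType) (N L : nat) (Xs : {fset int}).
Variables (phi : Xs -> F) (f : 'cV[Xs]_N -> R).

(* Membership in the N-fold product of the image of [phi]. *)
Definition mapped_vec : pred 'cV[F]_N :=
  fun v => [forall i : 'I_N, v i ord0 \in codom phi].

(* For injective [phi] the picked preimage is the only one. *)
Definition mapped_pmf (v : 'cV[F]_N) : R :=
  if [pick x : 'cV[Xs]_N | map_mx phi x == v] is Some x then f x else 0.

Definition MAP_metric (A : 'M[F]_(L, N)) (y : 'cV[F]_L) (v : 'cV[F]_N) : R :=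
  (A *m v == y)%:R * mapped_pmf v.

(* The argmax need not be unique, so any selection of a maximizer is a MAP
   decoder. *)
Definition MAP_decoder (dec : 'M[F]_(L, N) -> 'cV[F]_L -> 'cV[F]_N) : Prop :=
  forall (A : 'M[F]_(L, N)) (y : 'cV[F]_L),
    mapped_vec (dec A y) /\
    forall v : 'cV[F]_N, mapped_vec v ->
      MAP_metric A y v <= MAP_metric A y (dec A y).

(* Ties count as errors, whatever maximizer [dec] selects. *)
Definition MAP_error (dec : 'M[F]_(L, N) -> 'cV[F]_L -> 'cV[F]_N)
    (A : 'M[F]_(L, N)) (x : 'cV[Xs]_N) : Prop :=
  let xhat := map_mx phi x in
  dec A (A *m xhat) <> xhat \/
  exists w : 'cV[F]_N,
    [/\ mapped_vec w, w <> xhat, A *m w = A *m xhat &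
        mapped_pmf xhat <= mapped_pmf w].

End map_decoding.

Definition MAP_error_prob (R : realType) (F : finFieldType) (N L : nat)
    (Xs : {fset int}) (d : measure_display) (T : measurableType d)
    (P : probability T R) (X : T -> 'cV[Xs]_N) (A : T -> 'M[F]_(L, N))
    (phi : Xs -> F) (f : 'cV[Xs]_N -> R)
    (dec : 'M[F]_(L, N) -> 'cV[F]_L -> 'cV[F]_N) : \bar R :=
  P [set t | MAP_error phi f dec (A t) (X t)].

Section information.
Context (R : realType) (S : finType).
Implicit Types f g : S -> R.

(* [ln 0 = 0], hence [0 * log2 0 = 0]. *)
Definition log2 (x : R) : R := ln x / ln 2.

Definition entropy g : R := - \sum_(x : S) g x * log2 (g x).

(* Real-valued, so it is the Kullback-Leibler divergence only when the support
   of [g] is contained in that of [f]; this always holds for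
   [g = tilted rho f]. *)
Definition KL_divergence g f : R := \sum_(x : S) g x * log2 (g x / f x).

Definition tilted (rho : R) f : S -> R :=
  fun x => f x `^ (1 / (1 + rho)) / \sum_(x' : S) f x' `^ (1 / (1 + rho)).

Definition error_bound (q L : nat) f (rho : R) : R :=
  2 `^ (- (rho * L%:R * log2 q%:R) + rho * entropy (tilted rho f)
        - KL_divergence (tilted rho f) f).

End information.

(* Main.v *)
(** Gallager's random-coding argument.  If the MAP decoder fails on [x] with
    [0 < f x], some [w <> x] satisfies [f x <= f w] and [A (w - x) = 0]; for
    fixed [w] the latter has probability [q ^ -L].  Hence [P_e] is at most
    [\sum_x f x * min 1 (\sum_(w | f x <= f w) q ^ -L)].  Using
    [min 1 u <= u ^ rho] and [1 <= (f w / f x) ^ (1 / (1 + rho))] this is at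
    most [q ^ (- rho L) * Z ^ (1 + rho)] with [Z = \sum_x f x ^ (1 / (1 + rho))],
    which is the stated bound because
    [rho H_rho - D_KL (f_rho || f) = (1 + rho) log2 Z].  The minimum over
    [0 <= rho <= 1] is attained since the bound is continuous in [rho]. *)

Require Import Defs.
From HB Require Import structures.
From mathcomp Require Import all_boot all_order all_algebra finmap.
From mathcomp Require Import all_classical all_reals all_analysis.
From mathcomp Require Import ring.

Set Implicit Arguments.
Unset Strict Implicit.
Unset Printing Implicit Defensive.

Import Order.TTheory GRing.Theory Num.Theory.
Import numFieldNormedType.Exports.

Local Open Scope classical_set_scope.
Local Open Scope ring_scope.

(** * Laws of finite-valued random variables and of uniform random matrices *)

Lemma has_pmf_pred (R : realType) (d : measure_display) (T : measurableType d)
    (P : probability T R) (S : finType) (Y : T -> S) (p : S -> R)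
    (B : pred S) :
  finite_RV Y -> has_pmf P Y p ->
  P [set t | B (Y t)] = (\sum_(s | B s) p s)%:E.
Proof.
move=> Y_RV Y_pmf.
have -> : [set t | B (Y t)] = \bigcup_(s in [set` B]) (Y @^-1` [set s]).
  apply/seteqP; split => [t Bt|t [s Bs /= ->//]].
  by exists (Y t).
rewrite measure_fin_bigcup.
- rewrite -(@bigfs _ _ _ _ (index_enum S)) ?index_enum_uniq//; last first.
    by move=> s _; rewrite mem_index_enum.
  by rewrite -sumEFin; apply: eq_bigr => s _; rewrite -Y_pmf.
- exact: finite_finset.
- by move=> s1 s2 _ _ [t [/= -> ->]].
- by move=> s _; exact: Y_RV.
Qed.

Lemma has_pmf_ge0 (R : realType) (d : measure_display) (T : measurableType d)
    (P : probability T R) (S : finType) (Y : T -> S) (p : S -> R) (s : S) :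
  has_pmf P Y p -> 0 <= p s.
Proof. by move=> Y_pmf; rewrite -lee_fin -Y_pmf. Qed.

Lemma has_pmf_sum1 (R : realType) (d : measure_display) (T : measurableType d)
    (P : probability T R) (S : finType) (Y : T -> S) (p : S -> R) :
  finite_RV Y -> has_pmf P Y p -> \sum_s p s = 1.
Proof.
move=> Y_RV /(has_pmf_pred xpredT Y_RV).
have -> : [set _ : T | true] = setT by apply/seteqP; split.
by rewrite probability_setT => -[].
Qed.

Lemma iid_uniform_entries_pmf (R : realType) (d : measure_display)
    (T : measurableType d) (P : probability T R) (F : finFieldType)
    (L N : nat) (A : T -> 'M[F]_(L, N)) :
  iid_uniform_entries P A ->
  has_pmf P A (fun=> (#|F|%:R ^+ (L * N))^-1).
Proof.
move=> [A_unif A_ind] M.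
have /= := A_ind [set: 'I_L * 'I_N]%SET (fun ij => [set M ij.1 ij.2]).
have -> : \bigcap_(ij in [set` [set: 'I_L * 'I_N]%SET])
    ((fun t => A t ij.1 ij.2) @^-1` [set M ij.1 ij.2]) = A @^-1` [set M].
  apply/seteqP; split => [t At|t /= <- ij //].
  by apply/matrixP => i j; apply: (At (i, j)); rewrite /= finset.in_setT.
move=> ->; under eq_bigr => ij _ do rewrite A_unif.
by rewrite prodEFin prodr_const cardsT card_prod !card_ord exprVn.
Qed.

Lemma independent_pmf (R : realType) (d : measure_display)
    (T : measurableType d) (P : probability T R) (S1 S2 : finType)
    (Y1 : T -> S1) (Y2 : T -> S2) (p1 : S1 -> R) (p2 : S2 -> R) :
  independent_RV P Y1 Y2 -> has_pmf P Y1 p1 -> has_pmf P Y2 p2 ->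
  has_pmf P (fun t => (Y1 t, Y2 t)) (fun s => p1 s.1 * p2 s.2).
Proof.
move=> Y_ind Y1_pmf Y2_pmf [s1 s2] /=.
rewrite EFinM -Y1_pmf -Y2_pmf -Y_ind; congr (P _).
by apply/seteqP; split => t /= [-> ->].
Qed.

Lemma finite_RV_pair (d : measure_display)
    (T : measurableType d) (S1 S2 : finType) (Y1 : T -> S1) (Y2 : T -> S2) :
  finite_RV Y1 -> finite_RV Y2 -> finite_RV (fun t => (Y1 t, Y2 t)).
Proof.
move=> Y1_RV Y2_RV [s1 s2].
have -> : (fun t => (Y1 t, Y2 t)) @^-1` [set (s1, s2)] =
    Y1 @^-1` [set s1] `&` Y2 @^-1` [set s2].
  by apply/seteqP; split => t /= [-> ->].
exact: measurableI.
Qed.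

(** A nonzero coordinate of [v] makes the linear map [M |-> M *m v] surjective, so its [q ^ L]
    fibers are translates of the kernel and have equal size. A uniform matrix thus annihilates [v]
    with probability [q ^ -L]. *)
Lemma card_mulmx_eq0 (F : finFieldType) (L N : nat) (v : 'cV[F]_N) :
  v != 0 ->
  (#|F| ^ L * #|[pred M : 'M[F]_(L, N) | M *m v == 0%R]| = #|F| ^ (L * N))%N.
Proof.
move=> /cV0Pn[j vj0].
(* [lift y] has [y / v_j] as its column [j] and zeros elsewhere, hence sends [v] to [y]; adding it
   carries the kernel onto the fiber over [y]. *)
pose lift (y : 'cV[F]_L) : 'M[F]_(L, N) := y *m ((v j ord0)^-1 *: delta_mx 0 j).
have liftK y : lift y *m v = y.
  rewrite -mulmxA -scalemxAl -rowE.
  suff -> : (v j ord0)^-1 *: row j v = 1%:M by rewrite mulmx1.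
  apply/matrixP => a b; rewrite !mxE !ord1 eqxx mulVf//.
have card_fiber y :
      #|[pred M : 'M[F]_(L, N) | M *m v == y]| =
      #|[pred M : 'M[F]_(L, N) | M *m v == 0]|.
  rewrite -(fintype.card_image (addrI (lift y))
    [pred M : 'M[F]_(L, N) | M *m v == 0]).
  apply: eq_card => M; rewrite !inE; apply/eqP/fintype.imageP =>
    [Mv|[M0 /eqP M0v ->]].
    exists (M - lift y); last by rewrite addrC subrK.
    by rewrite inE mulmxBl liftK Mv subrr.
  by rewrite mulmxDl liftK M0v addr0.
rewrite -(card_mx F L N) -[RHS]sum1_card.
rewrite (partition_big (fun M => M *m v) xpredT)//=.
under eq_bigr => y _ do rewrite sum1_card card_fiber.
by rewrite sum_nat_const card_mx muln1.
Qed.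

(** * The tilted distribution, its normalizing constant and the exponent of the bound *)

Definition tilted_sum (R : realType) (S : finType) (f : S -> R) (rho : R) : R :=
  \sum_x f x `^ (1 / (1 + rho)).

Section tilting.
Context (R : realType) (S : finType) (f : S -> R).
Hypotheses (f_ge0 : forall x, 0 <= f x) (f_sum1 : \sum_x f x = 1).
Implicit Types rho : R.

(** Were the sum zero, every power and hence every [f x] would vanish, against total mass 1. *)
Lemma tilted_sum_gt0 rho : 0 < tilted_sum f rho.
Proof.
rewrite lt_neqAle sumr_ge0 ?andbT; last by move=> x _; exact: powR_ge0.
apply/eqP => /esym/eqP; rewrite psumr_eq0; last by move=> x _; exact: powR_ge0.
move=> /allP f0; have := oner_neq0 R; rewrite -f_sum1 big1 ?eqxx// => x _.
by apply: (@powR_eq0_eq0 _ _ (1 / (1 + rho))); apply/eqP/f0;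
  rewrite mem_index_enum.
Qed.

Lemma sum_tilted rho : \sum_x tilted rho f x = 1.
Proof. by rewrite -mulr_suml mulfV// gt_eqF// tilted_sum_gt0. Qed.

(* On the support of [f], [ln f_rho = ln f / (1 + rho) - ln Z] with
   [Z = tilted_sum f rho], so the logarithms of [f] cancel. *)
Lemma tilted_entropy_KL rho : 0 <= rho ->
  rho * entropy (tilted rho f) - KL_divergence (tilted rho f) f =
  (1 + rho) * ln (tilted_sum f rho) / ln 2.
Proof.
move=> rho0; rewrite /entropy /KL_divergence mulrN mulr_sumr.
rewrite -opprD -big_split/=.
(* The right side is written as its own average under [tilted rho f], so that the identity can be
   checked term by term. *)
rewrite -sumrN [RHS](_ : _ = \sum_x tilted rho f x *
    ((1 + rho) * ln (tilted_sum f rho) / ln 2)); last first.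
  by rewrite -mulr_suml sum_tilted mul1r.
apply: eq_bigr => x _.
have := f_ge0 x; rewrite le_eqVlt => /predU1P[fx0|fx_gt0].
  have -> : tilted rho f x = 0.
    rewrite /tilted -fx0 powR0 ?mul0r// mul1r invr_neq0// gt_eqF//.
    by rewrite ltr_wpDr.
  by rewrite !mul0r mulr0 addr0 oppr0.
have Z0 := tilted_sum_gt0 rho.
have ln_t : ln (tilted rho f x) = ln (f x) / (1 + rho) - ln (tilted_sum f rho).
  rewrite /tilted -/(tilted_sum f rho) ln_div ?posrE ?powR_gt0//.
  by rewrite ln_powR mul1r mulrC.
rewrite /log2 ln_div ?posrE ?divr_gt0 ?powR_gt0// ln_t.
have ln2 : ln 2 != 0 :> R by rewrite gt_eqF// ln_gt0// ltr1n.
by field; rewrite ln2 gt_eqF// ltr_wpDr.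
Qed.

(** The base 2 cancels, leaving [q ^ (- rho L) * Z ^ (1 + rho)] as a single exponential: a form that
    is easy to see continuous and that the random-coding estimate reaches directly. *)
Lemma error_boundE q L rho : (0 < q)%N -> 0 <= rho ->
  error_bound q L f rho =
  expR ((1 + rho) * ln (tilted_sum f rho) - rho * L%:R * ln q%:R).
Proof.
move=> q0 rho0; rewrite /error_bound -addrA tilted_entropy_KL//.
rewrite /powR gt_eqF ?ltr0n//; congr expR; rewrite /log2.
have ln2 : ln 2 != 0 :> R by rewrite gt_eqF// ln_gt0// ltr1n.
by field.
Qed.

Lemma tilted_sum_continuous rho :
  0 <= rho -> {for rho, continuous (tilted_sum f)}.
Proof.
move=> rho0.
have rho1 : 1 + rho != 0 by rewrite gt_eqF// ltr_wpDr.
rewrite /continuous_at /tilted_sum.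
apply: (@cvg_big R _ +%R 0) => [|x _]; first exact: add_continuous.
(* [powR] is defined by cases on a zero base. There the term is constantly 0 near [rho], because
   [-1 < rho] keeps the exponent [1 / (1 + r)] nonzero for [r] close to [rho], including negative
   [r] when [rho = 0]. *)
have [fx0|fx_neq0] := eqVneq (f x) 0.
  rewrite fx0 [X in _ --> X]powR0; last by rewrite mul1r invr_neq0.
  apply: cvg_near_cst; near=> r; apply/eqP; rewrite powR0// mul1r invr_neq0//.
  rewrite gt_eqF// -ltrBlDl sub0r; near: r.
  by apply: lt_nbhsr; rewrite (lt_le_trans _ rho0)// ltrN10.
rewrite /powR (negbTE fx_neq0).
apply: continuous_comp; last exact: continuous_expR.
apply: cvgM; last exact: cvg_cst.
apply: cvgM; first exact: cvg_cst.
by apply: cvgV => //; apply: cvgD; [exact: cvg_cst|exact: cvg_id].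
Unshelve. all: by end_near. Qed.

Lemma error_bound_min q L : (0 < q)%N ->
  exists2 rho0 : R, 0 <= rho0 <= 1 & forall rho, 0 <= rho <= 1 ->
    error_bound q L f rho0 <= error_bound q L f rho.
Proof.
move=> q0.
(* [g] agrees with the bound for [rho >= 0]; the extreme value theorem on [[0, 1]] is applied to
   it. *)
pose g rho := expR ((1 + rho) * ln (tilted_sum f rho) - rho * L%:R * ln q%:R).
have [|rho0 rho0_in rho0_min] := @EVT_min R g 0 1 ler01.
  apply: continuous_in_subspaceT => rho.
  rewrite inE/= in_itv/= => /andP[rho_ge0 _].
  apply: continuous_comp; last exact: continuous_expR.
  apply: cvgB.
    apply: cvgM; first by apply: cvgD; [exact: cvg_cst|exact: cvg_id].
    apply: continuous_comp; first exact: tilted_sum_continuous.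
    by apply: continuous_ln; exact: tilted_sum_gt0.
  by apply: cvgM; [apply: cvgM; [exact: cvg_id|]|]; exact: cvg_cst.
exists rho0; first by move: rho0_in; rewrite in_itv.
move=> rho rho01; have /rho0_min : rho \in `[0, 1] by rewrite in_itv.
move: rho0_in; rewrite in_itv /= => /andP[rho0_ge0 _].
by case/andP: rho01 => rho_ge0 _; rewrite !error_boundE.
Qed.

End tilting.

(** * Gallager's estimate for one transmitted vector *)

Lemma minr1_le_powR (R : realType) (u rho : R) :
  0 <= u -> 0 <= rho <= 1 -> Num.min 1 u <= u `^ rho.
Proof.
(* For [1 <= u] compare [rho] with the exponent 0, for [u < 1] with the exponent 1. *)
move=> u0 /andP[rho0 rho1]; have [u1|u1] := leP 1 u.
  by rewrite -[leLHS](powRr0 u) ler_powR.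
have [->|u_neq0] := eqVneq u 0; first exact: powR_ge0.
by apply: ger1_powR => //; rewrite lt_neqAle eq_sym u_neq0 u0 ltW.
Qed.

Lemma gallager_term (R : realType) (S : finType) (f : S -> R) (B : pred S)
    (x : S) (c rho : R) :
  0 < f x -> 0 <= c -> 0 <= rho <= 1 ->
  (forall w, B w -> f x <= f w) ->
  f x * Num.min 1 (\sum_(w | B w) c) <=
  (c * tilted_sum f rho) `^ rho * f x `^ (1 / (1 + rho)).
Proof.
move=> fx0 c0 rho01 B_le; have /andP[rho0 _] := rho01.
have Z0 : 0 <= tilted_sum f rho by apply: sumr_ge0 => w _; exact: powR_ge0.
(* This [s] solves [1 - s * rho = s]: the factor [f x] and the power [f x ^ (- s * rho)] recombine
   into [f x ^ s], whose sum over [x] is again the normalizing constant. *)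
set s := 1 / (1 + rho).
have s0 : 0 <= s by rewrite divr_ge0// addr_ge0.
have fxs0 := powR_gt0 s fx0.
(* Each [w] in [B] has [f x ^ s <= f w ^ s]; the sum of [f w ^ s] is then enlarged from [B] to all
   [w]. *)
have sum_le : \sum_(w | B w) c <= c * tilted_sum f rho / f x `^ s.
  rewrite ler_pdivlMr// mulr_suml mulr_sumr big_mkcond/=.
  apply: ler_sum => w _; case: ifPn => [Bw|_]; last first.
    by rewrite mulr_ge0// powR_ge0.
  rewrite ler_wpM2l//; rewrite -/s.
  apply: (ge0_ler_powR s0) (B_le _ Bw); rewrite nnegrE; first exact: ltW.
  exact: le_trans (ltW fx0) (B_le _ Bw).
rewrite -ler_pdivlMl//.
apply: (le_trans (minr1_le_powR _ rho01)); first by rewrite sumr_ge0.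
have cZ0 : 0 <= c * tilted_sum f rho by rewrite mulr_ge0.
apply: le_trans (ge0_ler_powR rho0 _ _ sum_le) _.
- by rewrite nnegrE sumr_ge0.
- by rewrite nnegrE divr_ge0// powR_ge0.
rewrite powRM// ?invr_ge0 ?powR_ge0// mulrCA ler_wpM2l ?powR_ge0//.
suff -> : (f x `^ s)^-1 `^ rho = (f x)^-1 * f x `^ s by [].
rewrite -powRN -powRrM -(powR_inv1 (ltW fx0)) -powRD; last first.
  by rewrite (gt_eqF fx0) implybT.
by congr (_ `^ _); rewrite /s; field; rewrite gt_eqF// ltr_wpDr.
Qed.

(** * Union bound over the competitors of a fixed source vector *)

Section union_bound.
Context (R : realType) (F : finFieldType) (N L : nat) (Xs : {fset int}).
Variables (phi : Xs -> F) (f : 'cV[Xs]_N -> R).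
Variable dec : 'M[F]_(L, N) -> 'cV[F]_L -> 'cV[F]_N.
Hypothesis phi_inj : injective phi.

Lemma map_phi_inj : injective (@map_mx _ _ phi N 1).
Proof.
move=> x y /matrixP xy; apply/matrixP => i j.
by apply: phi_inj; have := xy i j; rewrite !mxE.
Qed.

Lemma mapped_pmf_map (x : 'cV[Xs]_N) : mapped_pmf phi f (map_mx phi x) = f x.
Proof.
rewrite /mapped_pmf; case: pickP => [y /eqP/map_phi_inj -> //|/(_ x)].
by rewrite eqxx.
Qed.

Lemma mapped_vec_map (x : 'cV[Xs]_N) : mapped_vec phi (map_mx phi x).
Proof. by apply/forallP => i; rewrite mxE codom_f. Qed.

Lemma mapped_vecP (v : 'cV[F]_N) :
  mapped_vec phi v -> exists x : 'cV[Xs]_N, v = map_mx phi x.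
Proof.
move=> /forallP v_im; exists (\col_i iinv (v_im i)).
by apply/matrixP => i j; rewrite !mxE f_iinv ord1.
Qed.

(** Competitors of [x] under MAP decoding, ties included. The condition does not involve the matrix,
    so for each pair the average over matrices can be taken separately. *)
Definition confusable (x w : 'cV[Xs]_N) : bool := (w != x) && (f x <= f w).

(** A tie supplies the competitor. Otherwise the decoder output is one: its metric is at least
    [f x > 0], so its indicator cannot vanish and it satisfies the observed equations. *)
Lemma MAP_error_confusable (M : 'M[F]_(L, N)) (x : 'cV[Xs]_N) :
  MAP_decoder phi f dec -> 0 < f x -> MAP_error phi f dec M x ->
  exists2 w, confusable x w & M *m (map_mx phi w - map_mx phi x) == 0.
Proof.
move=> dec_MAP fx0 err.
have [w [w_vec w_neq Mw w_le]] : exists w : 'cV[F]_N,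
    [/\ mapped_vec phi w, w <> map_mx phi x, M *m w = M *m map_mx phi x &
        mapped_pmf phi f (map_mx phi x) <= mapped_pmf phi f w].
  case: err => // dec_neq.
  have [dec_vec /(_ _ (mapped_vec_map x))] := dec_MAP M (M *m map_mx phi x).
  rewrite /MAP_metric eqxx mul1r.
  case: eqP => [Mdec|_]; rewrite ?mul1r ?mul0r => dec_le.
    by exists (dec M (M *m map_mx phi x)).
  by move: fx0; rewrite -mapped_pmf_map ltNge dec_le.
have [z w_z] := mapped_vecP w_vec; subst w.
exists z; last by rewrite mulmxBr Mw subrr.
move: w_le; rewrite !mapped_pmf_map /confusable => ->; rewrite andbT.
by apply/eqP => z_x; apply: w_neq; rewrite z_x.
Qed.

(** The left side is the error probability given [X = x]. The cap 1 is the total mass of the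
    matrices; the other bound gives each competitor [w] the mass of the matrices annihilating the
    nonzero difference of the mapped vectors. *)
Lemma MAP_error_count (x : 'cV[Xs]_N) :
  MAP_decoder phi f dec -> 0 < f x ->
  \sum_(M | `[< MAP_error phi f dec M x >]) (#|F|%:R ^+ (L * N))^-1 <=
  Num.min 1 (\sum_(w | confusable x w) (#|F|%:R ^+ L)^-1) :> R.
Proof.
move=> dec_MAP fx0.
have q0 : 0 < #|F|%:R :> R by rewrite ltr0n; apply/card_gt0P; exists 0.
have qLN0 : 0 < (#|F|%:R ^+ (L * N))^-1 :> R by rewrite invr_gt0 exprn_gt0.
rewrite le_min; apply/andP; split.
  apply: (@le_trans _ _ (\sum_(M : 'M[F]_(L, N)) (#|F|%:R ^+ (L * N))^-1)).
    by rewrite big_mkcond ler_sum// => M _; case: ifP => // _; exact: ltW.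
  by rewrite sumr_const card_mx -[_ *+ _]mulr_natr natrX mulVf//
      gt_eqF// exprn_gt0.
pose K w := [pred M : 'M[F]_(L, N) | M *m (map_mx phi w - map_mx phi x) == 0].
apply: (@le_trans _ _ (\sum_(w | confusable x w) \sum_(M | K w M)
    (#|F|%:R ^+ (L * N))^-1)).
  (* After the exchange, each failing matrix is counted at least once, by a competitor it fails to
     separate from [x]. *)
  rewrite (exchange_big_dep xpredT)//= [leLHS]big_mkcond ler_sum// => M _.
  case: ifPn => [/asboolP err|_]; last by apply: sumr_ge0 => *; exact: ltW.
  have [w w_conf w_ker] := MAP_error_confusable dec_MAP fx0 err.
  rewrite (bigD1 w) ?w_conf//= lerDl; apply: sumr_ge0 => *; exact: ltW.
apply: ler_sum => w /andP[w_neq _].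
have dw : map_mx phi w - map_mx phi x != 0.
  by rewrite subr_eq0; apply: contra w_neq => /eqP/map_phi_inj ->.
rewrite sumr_const -[_ *+ _]mulr_natr.
have /(congr1 (fun n => n%:R : R)) := card_mulmx_eq0 L dw.
rewrite natrM !natrX => <-.
have qL0 : #|F|%:R ^+ L != 0 :> R by rewrite gt_eqF// exprn_gt0.
rewrite invfM -mulrA.
have [->|K0] := eqVneq (#|K w|%:R : R) 0; last by rewrite mulVf ?mulr1.
by rewrite !mulr0 invr_ge0 exprn_ge0// ltW.
Qed.

End union_bound.

(** * Averaging over the source and choosing the best [rho] *)

Lemma MAP_error_prob_le (R : realType) (F : finFieldType) (N L : nat)
    (Xs : {fset int}) (d : measure_display) (T : measurableType d)
    (P : probability T R)
    (X : T -> 'cV[Xs]_N) (A : T -> 'M[F]_(L, N))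
    (f : 'cV[Xs]_N -> R) (phi : Xs -> F)
    (dec : 'M[F]_(L, N) -> 'cV[F]_L -> 'cV[F]_N) (rho : R) :
  finite_RV X -> finite_RV A -> has_pmf P X f -> injective phi ->
  iid_uniform_entries P A -> independent_RV P A X -> MAP_decoder phi f dec ->
  0 <= rho <= 1 ->
  (MAP_error_prob P X A phi f dec <= (error_bound #|F| L f rho)%:E)%E.
Proof.
move=> X_RV A_RV X_pmf phi_inj A_iid AX_indep dec_MAP rho01.
have /andP[rho0 _] := rho01.
have f_ge0 x : 0 <= f x := has_pmf_ge0 x X_pmf.
have f_sum1 := has_pmf_sum1 X_RV X_pmf.
have q0 : (0 < #|F|)%N by apply/card_gt0P; exists 0.
have Z0 := tilted_sum_gt0 f_sum1 rho.
have qL0 : 0 < #|F|%:R ^+ L :> R by rewrite exprn_gt0// ltr0n.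
pose c : R := (#|F|%:R ^+ L)^-1.
have c0 : 0 < c by rewrite invr_gt0.
(* Independence makes the joint law a product, so the error probability is a finite double sum. *)
have -> : MAP_error_prob P X A phi f dec =
    (\sum_(M : 'M[F]_(L, N)) \sum_(x | `[< MAP_error phi f dec M x >])
       (#|F|%:R ^+ (L * N))^-1 * f x)%:E.
  rewrite pair_big_dep /= -(has_pmf_pred _ (finite_RV_pair A_RV X_RV)
    (independent_pmf AX_indep (iid_uniform_entries_pmf A_iid) X_pmf)).
  by congr (P _); apply/seteqP; split => t /=; rewrite asboolE.
rewrite lee_fin (exchange_big_dep xpredT)//=.
apply: (@le_trans _ _ (\sum_x (c * tilted_sum f rho) `^ rho *
    f x `^ (1 / (1 + rho)))).
  apply: ler_sum => x _; rewrite -mulr_suml mulrC.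
  (* Source vectors of probability zero contribute nothing, which leaves the case [0 < f x] required
     by the competitor argument. *)
  have := f_ge0 x; rewrite le_eqVlt => /predU1P[<-|fx0].
    by rewrite mul0r mulr_ge0// powR_ge0.
  apply: le_trans (gallager_term (B := confusable f x) fx0 (ltW c0) rho01 _).
    by rewrite ler_pM2l// MAP_error_count.
  by move=> w /andP[].
(* The sum is [(c * Z) ^ rho * Z] with [c = q ^ -L] and [Z = tilted_sum f rho], which equals the
   bound exactly. *)
rewrite -mulr_sumr -/(tilted_sum f rho) error_boundE//.
rewrite -[X in _ * X]lnK ?posrE// /powR gt_eqF ?mulr_gt0// -expRD ler_expR.
rewrite lnM ?posrE// /c lnV ?posrE// lnXn ?ltr0n// -[_ *+ L]mulr_natr.
by rewrite le_eqVlt; apply/orP; left; apply/eqP; ring.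
Qed.

Theorem proposition1 (R : realType) (F : finFieldType) (N L : nat)
    (Xs : {fset int}) (d : measure_display) (T : measurableType d)
    (P : probability T R)
    (X : T -> 'cV[Xs]_N) (A : T -> 'M[F]_(L, N))
    (f : 'cV[Xs]_N -> R) (phi : Xs -> F)
    (dec : 'M[F]_(L, N) -> 'cV[F]_L -> 'cV[F]_N)
    (X_RV : finite_RV X) (A_RV : finite_RV A)
    (X_pmf : has_pmf P X f)
    (leXq : (#|{: Xs}| <= #|F|)%N)
    (phi_inj : injective phi)
    (A_iid : iid_uniform_entries P A)
    (AX_indep : independent_RV P A X)
    (dec_MAP : MAP_decoder phi f dec) :
  exists rho0 : R,
    [/\ 0 <= rho0 <= 1,
        (forall rho : R, 0 <= rho <= 1 ->
           error_bound #|F| L f rho0 <= error_bound #|F| L f rho) &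
        (MAP_error_prob P X A phi f dec <= (error_bound #|F| L f rho0)%:E)%E].
Proof.
have q0 : (0 < #|F|)%N by apply/card_gt0P; exists 0.
have f_ge0 x : 0 <= f x := has_pmf_ge0 x X_pmf.
(* The estimate holds for each [rho] in [[0, 1]], in particular at a minimizer. *)
have [rho0 rho0_01 rho0_min] :=
  error_bound_min f_ge0 (has_pmf_sum1 X_RV X_pmf) L q0.
by exists rho0; split=> //; exact: MAP_error_prob_le.
Qed.
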